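(* Assume that $F:\mathbb{R}^d\to\mathbb{R}$ is twice continuously differentiable, that $F$ is bounded below by a scalar $\hat F$, and that the gradient of $F$ is $L$-Lipschitz continuous on $\mathbb{R}^d$. Let $w_0\in\mathbb{R}^d$ be the starting point and let $\{w_k\}_{k\ge0}$ be the iterates generated by the FLECS algorithm (with either Hessian approximation update and either search direction option), so that $w_{k+1}=w_k-\alpha_kA_k\nabla F(w_k)$, and let $0<\mu_1\le\mu_2$ be constants such that $\mu_1I\preceq A_k\preceq\mu_2I$ for all $k\ge0$. If the step-size is constant, $\alpha_k=\alpha$, with $0<\alpha\le\frac{\mu_1}{\mu_2^2L}$, then for every integer $T>0$ $$\frac1T\sum_{k=0}^{T-1}\|\nabla F(w_k)\|^2\le\frac{2[F(w_0)-\hat F]}{\alpha\mu_1T},$$ and the right-hand side tends to $0$ as $T\to\infty$.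
   Context: Problem: minimize $F(w)=\frac1n\sum_{i=1}^nf_i(w)$ over $w\in\mathbb{R}^d$ (possibly nonconvex), where $f_i$ is the loss of the $i$-th worker (the gradients and Hessians of $f_i$ used below are assumed to exist). $\|\cdot\|$ is the Euclidean norm, $\preceq$ is the Loewner order, $\dagger$ is the Moore–Penrose pseudo-inverse. Truncation: for a symmetric matrix $B=V\Lambda V^T$ (eigendecomposition with $V$ having orthonormal columns and $\Lambda$ diagonal) and $0<\omega\le\Omega$, let $|\Lambda|_\omega^\Omega$ be the diagonal matrix with entries $\min\{\max\{|\Lambda_{ii}|,\omega\},\Omega\}$, and $(|B|_\omega^\Omega)^{-1}:=V(|\Lambda|_\omega^\Omega)^{-1}V^T$. FLECS algorithm. Inputs: starting point $w_0$, memory size $m\le d$, symmetric initial matrices $B_0^i\in\mathbb{R}^{d\times d}$ ($i=1,\dots,n$), truncation constants $0<\omega<\Omega$, a (possibly random, biased or unbiased) compression operator $\mathcal{C}:\mathbb{R}^{d\times m}\to\mathbb{R}^{d\times m}$. At iteration $k\ge0$: 1. A sketching matrix $S_k\in\mathbb{R}^{d\times m}$ is sampled (the same on all machines). Worker $i$ computes $Y_k^i=\nabla^2f_i(w_k)S_k$, $M_k^i=S_k^TY_k^i$, $\nabla f_i(w_k)$, and $C_k^i=\mathcal{C}(Y_k^i-B_k^iS_k)$. 2. The server forms $\widetilde Y_k^i=C_k^i+B_k^iS_k$ and updates $B_k^i$ by one of: (a) Truncated L-SR1 update: with spectral decomposition $M_k^i-S_k^TB_k^iS_k=U_k^iL_k^i(U_k^i)^T$,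 let $[(L_k^i)^{-1}]_\omega$ be the (pseudo-)inverse of the diagonal matrix $L_k^i$ with all entries of absolute value at most $\omega$ set to $0$, and set $B_{k+1}^i=B_k^i+(\widetilde Y_k^i-B_k^iS_k)U_k^i[(L_k^i)^{-1}]_\omega(U_k^i)^T(\widetilde Y_k^i-B_k^iS_k)^T$; (b) Direct update: $B_{k+1}^i=(1-\beta_k)B_k^i+\beta_k\widetilde Y_k^i(M_k^i)^\dagger(\widetilde Y_k^i)^T$ with a learning rate $0<\beta_k\le1$. 3. The server forms $\nabla F(w_k)=\frac1n\sum_i\nabla f_i(w_k)$, $\widetilde Y_k=\frac1n\sum_i\widetilde Y_k^i$, $M_k=\frac1n\sum_iM_k^i$, $B_{k+1}=\frac1n\sum_iB_{k+1}^i$, and sets $w_{k+1}=w_k+\alpha_kp_k$ with $p_k=-A_k\nabla F(w_k)$, where $A_k$ is one of: (a) Truncated inverse Hessian approximation: $A_k=(|B_{k+1}|_\omega^\Omega)^{-1}$; (b) FedSONIA: take an economy QR factorization $\widetilde Y_k=Q_kR_k$ ($Q_k\in\mathbb{R}^{d\times m}$ with orthonormal columns, $R_k\in\mathbb{R}^{m\times m}$ upper triangular), the spectral decomposition $R_kM_k^\dagger R_k^T=V_k\Lambda_kV_k^T$, $\widetilde V_k=Q_kV_k$, and $A_k=\widetilde V_k(|\Lambda_k|_\omega^\Omega)^{-1}\widetilde V_k^T+\rho_k(I-\widetilde V_k\widetilde V_k^T)$, where $\rho_k\in\left[\frac1\Omega,\ \frac{1}{\max_i[(|\Lambda_k|_\omega^\Omega)^{-1}]_{ii}}\right]$.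 *)

(* Defs.v *)
From mathcomp Require Import all_boot all_order all_algebra.
From mathcomp Require Import all_classical all_reals all_analysis.

Set Implicit Arguments.
Unset Strict Implicit.
Unset Printing Implicit Defensive.

Import Order.TTheory GRing.Theory Num.Theory.
Import numFieldNormedType.Exports.
Local Open Scope classical_set_scope.
Local Open Scope ring_scope.

(* The norm `|x| of the library on 'cV[R]_d is the sup norm.  Differentiability
   and continuity do not depend on the choice; the estimates below do. *)
Definition enorm (R : realType) (d : nat) (x : 'cV[R]_d) : R :=
  Num.sqrt (\sum_i x i 0 ^+ 2).

(* 'D_v f x is total: gradient and hessian are only meaningful together with
   the differentiability conditions twice_differentiable_at and C2. *)
Definition gradient (R : realType) (d : nat) (f : 'cV[R]_d -> R)
    (x : 'cV[R]_d) : 'cV[R]_d :=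
  \col_i 'D_(delta_mx i 0) f x.

Definition hessian (R : realType) (d : nat) (f : 'cV[R]_d -> R)
    (x : 'cV[R]_d) : 'M[R]_d :=
  \matrix_(i, j) 'D_(delta_mx j 0) (fun y => gradient f y i 0) x.

Definition twice_differentiable_at (R : realType) (d : nat)
    (f : 'cV[R]_d -> R) (x : 'cV[R]_d) : Prop :=
  (\forall y \near x, differentiable f y) /\ differentiable (gradient f) x.

Definition C2 (R : realType) (d : nat) (f : 'cV[R]_d -> R) : Prop :=
  (forall x, twice_differentiable_at f x) /\ continuous (hessian f).

Definition lipschitz_gradient (R : realType) (d : nat) (L : R)
    (f : 'cV[R]_d -> R) : Prop :=
  forall x y, enorm (gradient f x - gradient f y) <= L * enorm (x - y).

Definition psd (R : realType) (d : nat) (A : 'M[R]_d) : Prop :=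
  A^T = A /\ forall x : 'cV[R]_d, 0 <= (x^T *m A *m x) 0 0.

Definition loewner_le (R : realType) (d : nat) (A B : 'M[R]_d) : Prop :=
  psd (B - A).

(* The four Penrose conditions; the library's pinvmx is a different, merely
   partial, inverse. *)
Definition is_pinv (R : realType) (p q : nat)
    (A : 'M[R]_(p, q)) (X : 'M[R]_(q, p)) : Prop :=
  [/\ A *m X *m A = A, X *m A *m X = X,
      (A *m X)^T = A *m X & (X *m A)^T = X *m A].

Definition spectral_decomposition (R : realType) (p : nat)
    (B V : 'M[R]_p) (lam : 'rV[R]_p) : Prop :=
  V^T *m V = 1%:M /\ B = V *m diag_mx lam *m V^T.

Definition clamp (R : realType) (omega Omega x : R) : R :=
  Num.min (Num.max `|x| omega) Omega.

Definition clamp_diag (R : realType) (p : nat) (omega Omega : R)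
    (lam : 'rV[R]_p) : 'M[R]_p :=
  diag_mx (map_mx (clamp omega Omega) lam).

(* A = (|B|_omega^Omega)^-1 *)
Definition is_truncated_inverse (R : realType) (p : nat) (omega Omega : R)
    (B A : 'M[R]_p) : Prop :=
  exists (V : 'M[R]_p) (lam : 'rV[R]_p),
    spectral_decomposition B V lam /\
    A = V *m invmx (clamp_diag omega Omega lam) *m V^T.

Definition threshold (R : realType) (omega x : R) : R :=
  if `|x| <= omega then 0 else x.

Definition average (R : realType) (V : lmodType R) (n : nat) (x : 'I_n -> V) : V :=
  n%:R^-1 *: \sum_i x i.

Inductive hessian_option := TruncatedLSR1 | DirectUpdate.

Inductive direction_option := TruncatedInverse | FedSONIA.

(* Bnext is an admissible update of B; Yt is the server's \widetilde Y.
   Relational, since the spectral decomposition is not unique. *)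
Definition hessian_update (R : realType) (d m : nat) (opt : hessian_option)
    (omega beta : R) (S : 'M[R]_(d, m)) (M : 'M[R]_m) (Yt : 'M[R]_(d, m))
    (B Bnext : 'M[R]_d) : Prop :=
  match opt with
  | TruncatedLSR1 =>
      exists (U : 'M[R]_m) (lam : 'rV[R]_m) (Linv : 'M[R]_m),
        [/\ spectral_decomposition (M - S^T *m B *m S) U lam,
            is_pinv (diag_mx (map_mx (threshold omega) lam)) Linv &
            Bnext = B + (Yt - B *m S) *m U *m Linv *m U^T *m (Yt - B *m S)^T]
  | DirectUpdate =>
      exists Mdag : 'M[R]_m,
        [/\ 0 < beta <= 1, is_pinv M Mdag &
            Bnext = (1 - beta) *: B + beta *: (Yt *m Mdag *m Yt^T)]
  end.

(* A is an admissible matrix for the search direction - A *m gradient F w.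
   is_trig_mx means lower triangular, hence the transpose on the QR factor.
   The entries maximized over are positive, so 0 is a neutral start for the
   max when 0 < m; for m = 0 the range of rho is empty. *)
Definition direction_matrix (R : realType) (d m : nat) (opt : direction_option)
    (omega Omega rho : R) (B : 'M[R]_d) (Yt : 'M[R]_(d, m)) (M : 'M[R]_m)
    (A : 'M[R]_d) : Prop :=
  match opt with
  | TruncatedInverse => is_truncated_inverse omega Omega B A
  | FedSONIA =>
      exists (Q : 'M[R]_(d, m)) (Rf Mdag V : 'M[R]_m) (lam : 'rV[R]_m),
        [/\ Yt = Q *m Rf, Q^T *m Q = 1%:M & is_trig_mx Rf^T] /\
        [/\ is_pinv M Mdag & spectral_decomposition (Rf *m Mdag *m Rf^T) V lam] /\
        let Vt := Q *m V in
        let Linv := invmx (clamp_diag omega Omega lam) in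
        Omega^-1 <= rho <= (\big[Num.max/0]_i Linv i i)^-1 /\
        A = Vt *m Linv *m Vt^T + rho *: (1%:M - Vt *m Vt^T)
  end.

Definition sketched_hessian (R : realType) (d m : nat) (f : 'cV[R]_d -> R)
    (S : 'M[R]_(d, m)) (w : 'cV[R]_d) : 'M[R]_(d, m) :=
  hessian f w *m S.

Definition sketched_core (R : realType) (d m : nat) (f : 'cV[R]_d -> R)
    (S : 'M[R]_(d, m)) (w : 'cV[R]_d) : 'M[R]_m :=
  S^T *m sketched_hessian f S w.

Definition server_sketch (R : realType) (d m : nat)
    (comp : 'M[R]_(d, m) -> 'M[R]_(d, m)) (f : 'cV[R]_d -> R)
    (S : 'M[R]_(d, m)) (B : 'M[R]_d) (w : 'cV[R]_d) : 'M[R]_(d, m) :=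
  comp (sketched_hessian f S w - B *m S) + B *m S.

(* One realization of FLECS.  The compression operator C takes a seed in the
   arbitrary type Xi; xi k i is the seed drawn by worker i at iteration k and
   S k the sampled sketching matrix.  A deterministic operator ignores its
   seed.  Each option may be chosen anew at every iteration. *)
Record flecs_run (R : realType) (d m n : nat) (Xi : Type)
    (f : 'I_n -> 'cV[R]_d -> R)
    (C : Xi -> 'M[R]_(d, m) -> 'M[R]_(d, m))
    (omega Omega : R) (w0 : 'cV[R]_d) (B0 : 'I_n -> 'M[R]_d)
    (hopt : nat -> hessian_option) (dopt : nat -> direction_option)
    (alpha beta rho : nat -> R)
    (xi : nat -> 'I_n -> Xi) (S : nat -> 'M[R]_(d, m))
    (w : nat -> 'cV[R]_d) (B : nat -> 'I_n -> 'M[R]_d)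
    (A : nat -> 'M[R]_d) : Prop := FlecsRun {
  flecs_init_w : w 0%N = w0;
  flecs_init_B : forall i, B 0%N i = B0 i;
  flecs_hessian : forall k i,
    hessian_update (hopt k) omega (beta k) (S k)
      (sketched_core (f i) (S k) (w k))
      (server_sketch (C (xi k i)) (f i) (S k) (B k i) (w k))
      (B k i) (B k.+1 i);
  flecs_direction : forall k,
    direction_matrix (dopt k) omega Omega (rho k)
      (average (fun i => B k.+1 i))
      (average (fun i => server_sketch (C (xi k i)) (f i) (S k) (B k i) (w k)))
      (average (fun i => sketched_core (f i) (S k) (w k)))
      (A k);
  flecs_step : forall k,
    w k.+1 = w k + alpha k *: (- (A k *m average (fun i => gradient (f i) (w k))))
}.

(* Main.v *)
Require Import Defs.
From mathcomp Require Import all_boot all_order all_algebra.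
From mathcomp Require Import all_classical all_reals all_analysis.
From mathcomp Require Import ring lra.

(** The argument is that of preconditioned gradient descent: the server's
    direction is - A_k applied to the exact gradient of F (gradient_average),
    and mu1 I <= A_k <= mu2 I in the Loewner order.

    A function with L-Lipschitz gradient stays below the parabola
    F x + <grad F x, p> + (L/2) |p|^2 (lipschitz_gradient_quadratic_bound).
    For the step p = - a A g with g = grad F x, both terms in p are controlled
    by the single number q = <g, A g>: the linear one is - a q, and, because
    |A g|^2 <= mu2 q (sqr_le_quad_of_loewner), the quadratic one is at most
    (L a^2 mu2 / 2) q.  The restriction a <= mu1 / (mu2^2 L) makes
    a L mu2 <= 1, so at least half of the linear decrease survives:
    F decreases by a q / 2, hence by (a mu1 / 2) |g|^2
    (descent_preconditioned_step).  Summing these decreases telescopes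
    (sum_le_telescope), and the total cannot exceed F w0 - Fhat.  Dividing by
    T gives the bound, a constant over T, which tends to 0. *)

Set Implicit Arguments.
Unset Strict Implicit.
Unset Printing Implicit Defensive.

Import Order.TTheory GRing.Theory Num.Theory.
Import numFieldNormedType.Exports.
Local Open Scope classical_set_scope.
Local Open Scope ring_scope.

(** * The Euclidean inner product on column vectors *)

Definition dotv (R : realType) (d : nat) (u v : 'cV[R]_d) : R :=
  (u^T *m v) 0 0.

Lemma dotvE (R : realType) (d : nat) (u v : 'cV[R]_d) :
  dotv u v = \sum_i u i 0 * v i 0.
Proof. by rewrite /dotv mxE; apply: eq_bigr => i _; rewrite mxE. Qed.

Lemma dotvC (R : realType) (d : nat) (u v : 'cV[R]_d) : dotv u v = dotv v u.
Proof. by rewrite !dotvE; apply: eq_bigr => i _; rewrite mulrC. Qed.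

Lemma dotvDr (R : realType) (d : nat) (u v w : 'cV[R]_d) :
  dotv u (v + w) = dotv u v + dotv u w.
Proof. by rewrite /dotv mulmxDr mxE. Qed.

Lemma dotvZr (R : realType) (d : nat) (c : R) (u v : 'cV[R]_d) :
  dotv u (c *: v) = c * dotv u v.
Proof. by rewrite /dotv -scalemxAr mxE. Qed.

Lemma dotvNr (R : realType) (d : nat) (u v : 'cV[R]_d) :
  dotv u (- v) = - dotv u v.
Proof. by rewrite -scaleN1r dotvZr mulN1r. Qed.

Lemma dotvDl (R : realType) (d : nat) (u v w : 'cV[R]_d) :
  dotv (v + w) u = dotv v u + dotv w u.
Proof. by rewrite dotvC dotvDr !(dotvC u). Qed.

Lemma dotvZl (R : realType) (d : nat) (c : R) (u v : 'cV[R]_d) :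
  dotv (c *: u) v = c * dotv u v.
Proof. by rewrite dotvC dotvZr dotvC. Qed.

Lemma dotvNl (R : realType) (d : nat) (u v : 'cV[R]_d) :
  dotv (- u) v = - dotv u v.
Proof. by rewrite dotvC dotvNr dotvC. Qed.

Lemma dotv_mulmxl (R : realType) (d : nat) (A : 'M[R]_d) (u v : 'cV[R]_d) :
  dotv (A *m u) v = dotv u (A^T *m v).
Proof. by rewrite /dotv trmx_mul mulmxA. Qed.

Lemma dotvv_ge0 (R : realType) (d : nat) (u : 'cV[R]_d) : 0 <= dotv u u.
Proof. by rewrite dotvE sumr_ge0// => i _; rewrite -expr2 sqr_ge0. Qed.

Lemma enorm_sqr (R : realType) (d : nat) (u : 'cV[R]_d) :
  enorm u ^+ 2 = dotv u u.
Proof.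
rewrite /enorm dotvE sqr_sqrtr; first by apply: eq_bigr => i _; rewrite expr2.
by rewrite sumr_ge0// => i _; rewrite sqr_ge0.
Qed.

Lemma enorm_ge0 (R : realType) (d : nat) (u : 'cV[R]_d) : 0 <= enorm u.
Proof. exact: sqrtr_ge0. Qed.

Lemma enormZ (R : realType) (d : nat) (c : R) (u : 'cV[R]_d) :
  0 <= c -> enorm (c *: u) = c * enorm u.
Proof.
move=> c0; apply/eqP.
rewrite -(@eqrXn2 _ 2) ?mulr_ge0 ?enorm_ge0// exprMn !enorm_sqr.
by rewrite dotvZl dotvZr mulrA.
Qed.

(** This is the form in which Cauchy-Schwarz is needed along a segment.  It
    follows directly from |u - c v|^2 >= 0, since the assumption bounds |u|^2
    by c^2 |v|^2; dividing by c is the reason for c > 0. *)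
Lemma dotv_enorm_le (R : realType) (d : nat) (c : R) (u v : 'cV[R]_d) :
  0 < c -> enorm u <= c * enorm v -> dotv u v <= c * enorm v ^+ 2.
Proof.
move=> c0 uv.
have uv2 : dotv u u <= c ^+ 2 * dotv v v.
  by rewrite -!enorm_sqr -exprMn lerXn2r ?nnegrE ?mulr_ge0 ?enorm_ge0 ?(ltW c0).
have := dotvv_ge0 (u - c *: v).
rewrite dotvDl !dotvDr !dotvNl !dotvNr !dotvZl !dotvZr (dotvC v u) => h.
by rewrite enorm_sqr -(ler_pM2l c0); nra.
Qed.

(** * Matrices between two multiples of the identity *)

Lemma loewner_lower_quad (R : realType) (d : nat) (c : R) (A : 'M[R]_d)
    (x : 'cV[R]_d) :
  loewner_le c%:M A -> c * dotv x x <= dotv x (A *m x).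
Proof.
move=> [_ /(_ x)].
rewrite -mulmxA -/(dotv x _) mulmxBl mul_scalar_mx.
by rewrite dotvDr dotvNr dotvZr subr_ge0.
Qed.

Lemma loewner_upper_quad (R : realType) (d : nat) (c : R) (A : 'M[R]_d)
    (x : 'cV[R]_d) :
  loewner_le A c%:M -> dotv x (A *m x) <= c * dotv x x.
Proof.
move=> [_ /(_ x)].
rewrite -mulmxA -/(dotv x _) mulmxBl mul_scalar_mx.
by rewrite dotvDr dotvNr dotvZr subr_ge0.
Qed.

Lemma loewner_lower_sym (R : realType) (d : nat) (c : R) (A : 'M[R]_d) :
  loewner_le c%:M A -> A^T = A.
Proof. by case=> + _; rewrite linearB/= tr_scalar_mx => /addIr. Qed.

(** Cauchy-Schwarz for the semidefinite form of A, tested on one vector.  The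
    form is nonnegative at c2 x - A x; expanding, its value is
    c2^2 <x, A x> - 2 c2 |A x|^2 + <A x, A A x>, and the last term is at most
    c2 |A x|^2.  Dividing by c2 leaves the claim.  Unlike
    |A x| <= c2 |x|, the bound keeps <x, A x>, the quantity by which a step
    along - A x decreases F to first order when x is the gradient. *)
Lemma sqr_le_quad_of_loewner (R : realType) (d : nat) (c1 c2 : R) (A : 'M[R]_d)
    (x : 'cV[R]_d) :
  0 <= c1 -> 0 < c2 -> loewner_le c1%:M A -> loewner_le A c2%:M ->
  dotv (A *m x) (A *m x) <= c2 * dotv x (A *m x).
Proof.
move=> c10 c20 lA uA; set u := A *m x.
have Asym := loewner_lower_sym lA.
have uAu := loewner_upper_quad u uA.
have : 0 <= dotv (c2 *: x - u) (A *m (c2 *: x - u)).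
  apply: le_trans (loewner_lower_quad _ lA).
  by rewrite mulr_ge0 ?dotvv_ge0.
rewrite mulmxBr -scalemxAr -/u dotvDl !dotvDr !dotvNl !dotvNr !dotvZl !dotvZr.
have -> : dotv x (A *m u) = dotv u u by rewrite -{1}Asym -dotv_mulmxl.
move=> h; rewrite -(ler_pM2l c20); nra.
Qed.

(** * Gradients and the quadratic upper bound *)

Lemma derive_gradient (R : realType) (d : nat) (F : 'cV[R]_d -> R)
    (x p : 'cV[R]_d) :
  differentiable F x -> 'D_p F x = dotv (gradient F x) p.
Proof.
move=> dF; rewrite deriveE// dotvE {1}[p]matrix_sum_delta linear_sum/=.
by apply: eq_bigr => i _; rewrite big_ord1 linearZ/= mxE -deriveE// mulrC.
Qed.

(** The workers' average gradient is the true gradient: this is what turns the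
    update of the algorithm into a gradient step for F.  Differentiability of
    each f i is needed, as directional derivatives of a sum of
    non-differentiable functions need not add up. *)
Lemma gradient_average (R : realType) (d n : nat) (f : 'I_n -> 'cV[R]_d -> R)
    (F : 'cV[R]_d -> R) (x : 'cV[R]_d) :
  (forall y, F y = n%:R^-1 * \sum_(i < n) f i y) ->
  (forall i, differentiable (f i) x) ->
  gradient F x = average (fun i => gradient (f i) x).
Proof.
move=> FE df; apply/colP => j; rewrite !mxE summxE.
have -> : F = n%:R^-1 \*: \sum_(i < n) f i.
  by apply/funext => y; rewrite FE /= fct_sumE.
rewrite deriveZ; last by apply: derivable_sum => i; exact: diff_derivable.
rewrite derive_sum; last by move=> i; exact: diff_derivable.
by congr (_ * _); apply: eq_bigr => i _; rewrite mxE.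
Qed.

(** A directional derivative at x + t p and the derivative at t of the
    restriction to the line have the same difference quotients. *)
Lemma is_derive_along_line (R : realType) (d : nat) (F : 'cV[R]_d -> R)
    (x p : 'cV[R]_d) (t : R) :
  differentiable F (x + t *: p) ->
  is_derive t 1 (fun s : R => F (x + s *: p))
    (dotv (gradient F (x + t *: p)) p).
Proof.
move=> dF; rewrite -derive_gradient//.
have quotE :
    (fun h : R => h^-1 *: (F (x + (h *: 1 + t) *: p) - F (x + t *: p)))
    = (fun h : R => h^-1 *: (F (h *: p + (x + t *: p)) - F (x + t *: p))).
  apply/funext => h; congr (_ *: (F _ - _)).
  by rewrite [h *: 1]mulr1 scalerDl addrCA.
split; first by rewrite /derivable quotE; exact: diff_derivable.
by rewrite /derive quotE.
Qed.

(** Subtracting from t |-> F (x + t p) the linear and quadratic terms of the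
    parabola leaves a function g with g 0 = F x and derivative
    <grad F (x + t p) - grad F x, p> - L t |p|^2, which the Lipschitz
    condition makes nonpositive for t > 0.  The mean value theorem on [0, 1]
    then gives g 1 <= g 0, without integrating the gradient. *)
Lemma lipschitz_gradient_quadratic_bound (R : realType) (d : nat)
    (F : 'cV[R]_d -> R) (L : R) (x p : 'cV[R]_d) :
  0 < L -> (forall y, differentiable F y) -> lipschitz_gradient L F ->
  F (x + p) <= F x + dotv (gradient F x) p + L / 2 * dotv p p.
Proof.
move=> L0 dF lipF.
set b := dotv (gradient F x) p; set c := L / 2 * dotv p p.
pose g (t : R) : R := F (x + t *: p) - (t * b + t ^+ 2 * c).
pose dg (t : R) : R := dotv (gradient F (x + t *: p)) p - (b + 2 * t * c).
have g_derive (t : R) : is_derive t 1 g (dg t).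
  have h := is_derive_along_line (dF (x + t *: p)).
  have hq : is_derive t 1 (fun s : R => s * b + s ^+ 2 * c) (b + 2 * t * c).
    apply: is_derive_eq; rewrite /GRing.scale /=; ring.
  exact: is_deriveB.
have [|t] := @MVT R g dg 0 1 ltr01 (fun t _ => g_derive t).
  apply: derivable_within_continuous => t _; exact: ex_derive.
rewrite in_itv/= => /andP[t0 t1].
have : dg t <= 0.
  rewrite /dg /b subr_le0 -lerBlDl -dotvNl -dotvDl.
  apply: le_trans (_ : L * t * enorm p ^+ 2 <= _).
    apply: dotv_enorm_le; first exact: mulr_gt0.
    have := lipF (x + t *: p) x; rewrite addrAC subrr add0r.
    by rewrite enormZ ?(ltW t0)// mulrA.
  rewrite /c enorm_sqr; nra.
rewrite /g scale1r scale0r addr0 subr0 => h1 h2; nra.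
Qed.

(** * Sufficient decrease and summation *)

(** With q = <grad F x, A grad F x>, half of the first-order decrease a q pays
    for the second-order term L a^2 |A grad F x|^2 / 2, and q >= mu1 |grad F x|^2
    converts the other half. *)
Lemma descent_preconditioned_step (R : realType) (d : nat)
    (F : 'cV[R]_d -> R) (L mu1 mu2 a : R) (A : 'M[R]_d) (x : 'cV[R]_d) :
  0 < L -> (forall y, differentiable F y) -> lipschitz_gradient L F ->
  0 < mu1 <= mu2 -> 0 < a <= mu1 / (mu2 ^+ 2 * L) ->
  loewner_le mu1%:M A -> loewner_le A mu2%:M ->
  a * mu1 / 2 * enorm (gradient F x) ^+ 2
    <= F x - F (x + a *: (- (A *m gradient F x))).
Proof.
move=> L0 dF lipF /andP[mu1_gt0 le_mu] /andP[a0 a_le] lA uA.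
have mu2_gt0 : 0 < mu2 by exact: lt_le_trans le_mu.
set g := gradient F x; set q := dotv g (A *m g).
have := lipschitz_gradient_quadratic_bound x (a *: (- (A *m g))) L0 dF lipF.
rewrite -/g !(dotvZr, dotvZl, dotvNr, dotvNl) -/q => Fdec.
have gq : mu1 * dotv g g <= q by exact: loewner_lower_quad.
have Aq : dotv (A *m g) (A *m g) <= mu2 * q.
  by apply: sqr_le_quad_of_loewner lA uA => //; exact: ltW.
have q0 : 0 <= q by apply: le_trans gq; rewrite mulr_ge0 ?dotvv_ge0 ?ltW.
have aL : a * L * mu2 <= 1.
  (* the assumption reads a L mu2^2 <= mu1, and mu1 <= mu2 *)
  move: a_le; rewrite ler_pdivlMr ?mulr_gt0 ?exprn_gt0// => h.
  rewrite -(ler_pM2r mu2_gt0); nra.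
have quad_le : L * a * dotv (A *m g) (A *m g) <= q.
  apply: le_trans (_ : L * a * (mu2 * q) <= _).
    by rewrite ler_pM2l// mulr_gt0.
  by have := ler_wpM2r q0 aL; nra.
have := ler_wpM2l (ltW a0) quad_le; have := ler_wpM2l (ltW a0) gq.
rewrite enorm_sqr; nra.
Qed.

Lemma sum_le_telescope (R : realType) (u v : nat -> R) (b : R) (T : nat) :
  (forall k, u k <= v k - v k.+1) -> (forall k, b <= v k) ->
  \sum_(0 <= k < T) u k <= v 0%N - b.
Proof.
move=> uv bv; apply: le_trans (_ : v 0%N - v T <= _); last by rewrite lerB.
rewrite -opprB -(telescope_sumr _ (leq0n T)) -sumrN.
by apply: ler_sum => k _; rewrite opprB.
Qed.

Theorem theorem3 (R : realType) (d m n : nat) (Xi : Type)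
    (F : 'cV[R]_d -> R) (f : 'I_n -> 'cV[R]_d -> R)
    (C : Xi -> 'M[R]_(d, m) -> 'M[R]_(d, m))
    (omega Omega : R) (w0 : 'cV[R]_d) (B0 : 'I_n -> 'M[R]_d)
    (hopt : nat -> hessian_option) (dopt : nat -> direction_option)
    (alpha beta rho : nat -> R)
    (xi : nat -> 'I_n -> Xi) (S : nat -> 'M[R]_(d, m))
    (w : nat -> 'cV[R]_d) (B : nat -> 'I_n -> 'M[R]_d) (A : nat -> 'M[R]_d)
    (Fhat L mu1 mu2 a : R)
    (n_gt0 : (0 < n)%N) (le_md : (m <= d)%N)
    (FE : forall x, F x = n%:R^-1 * \sum_(i < n) f i x)
    (omega_bounds : 0 < omega < Omega)
    (B0_sym : forall i, (B0 i)^T = B0 i)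
    (run : flecs_run f C omega Omega w0 B0 hopt dopt alpha beta rho xi S w B A)
    (f_diff : forall k i, twice_differentiable_at (f i) (w k))
    (F_C2 : C2 F)
    (F_lower : forall x, Fhat <= F x)
    (L_gt0 : 0 < L)
    (F_lip : lipschitz_gradient L F)
    (mu_bounds : 0 < mu1 <= mu2)
    (A_bounds : forall k,
      loewner_le mu1%:M (A k) /\ loewner_le (A k) mu2%:M)
    (alpha_const : forall k, alpha k = a)
    (a_bounds : 0 < a <= mu1 / (mu2 ^+ 2 * L)) :
  (forall T : nat, (0 < T)%N ->
     T%:R^-1 * \sum_(0 <= k < T) enorm (gradient F (w k)) ^+ 2
       <= 2 * (F w0 - Fhat) / (a * mu1 * T%:R)) /\
  (fun T : nat => 2 * (F w0 - Fhat) / (a * mu1 * T%:R)) @ \oo --> (0 : R).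
Proof.
have a_gt0 : 0 < a by case/andP: a_bounds.
have mu1_gt0 : 0 < mu1 by case/andP: mu_bounds.
have F_diff y : differentiable F y.
  by have [+ _] := F_C2.1 y; exact: nbhs_singleton.
have step k : w k.+1 = w k + a *: (- (A k *m gradient F (w k))).
  rewrite (flecs_step run) alpha_const (gradient_average FE)// => i.
  by have [+ _] := f_diff k i; exact: nbhs_singleton.
split=> [T T_gt0|].
  have := @sum_le_telescope R
    (fun k => a * mu1 / 2 * enorm (gradient F (w k)) ^+ 2)
    (fun k => F (w k)) Fhat T _ (fun k => F_lower (w k)).
  rewrite (flecs_init_w run) -mulr_sumr => sum_le.
  have T0 : 0 < T%:R :> R by rewrite ltr0n.
  rewrite ler_pdivlMr ?mulr_gt0//.
  set total := \sum_(0 <= k < T) _ in sum_le *.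
  have -> : T%:R^-1 * total * (a * mu1 * T%:R) = 2 * (a * mu1 / 2 * total).
    by field; rewrite gt_eqF.
  rewrite ler_pM2l//; apply: sum_le => k; rewrite step.
  by apply: descent_preconditioned_step F_lip _ _ (A_bounds k).1 (A_bounds k).2.
(* harmonic T is 1 / (T + 1): the sequence is shifted by one index *)
rewrite -cvg_shiftS/=; set u := (fun _ => _).
have -> : u = (fun T => 2 * (F w0 - Fhat) / (a * mu1) * harmonic T).
  by apply/funext => T; rewrite /u invfM mulrA.
set c := 2 * (F w0 - Fhat) / (a * mu1).
have : c * harmonic T @[T --> \oo] --> c * 0.
  by apply: cvgMr; exact: cvg_harmonic.
by rewrite mulr0.
Qed.
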